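(* Let $\Gamma$ be an abelian group with identity $e$, let $R$ be a $\Gamma$-graded ring and $M$ a $\Gamma$-graded $R$-module. Then $p\mathfrak{Der}^{gh}_\Gamma(R,M)$ forms a $Z(R)\cap R_e$-module under pointwise operations and the scalar multiplication $a\cdot(F_M,d)_{h,M}=(aF_M,ad)_{h,M}$ for $a\in Z(R)\cap R_e$.
   Context: A ring $R$ is $\Gamma$-graded if $R=\bigoplus_{\tau\in\Gamma}R_\tau$ as additive groups with $R_\tau R_\sigma\subseteq R_{\tau\sigma}$; a graded $R$-module is a (left) $R$-module $M=\bigoplus_{\tau\in\Gamma}M_\tau$ with $R_\sigma M_\tau\subseteq M_{\sigma\tau}$. $Z(R)$ is the center of $R$. $p\mathfrak{Der}^{gh}_\Gamma(R,M)$ is the set of gr-generalized derivations on $M$: pairs $(F_M,d)_{h,M}$ where $d:R\to R$ is a derivation with $d(R_\tau)\subseteq R_\tau$ for all $\tau$, and $F_M:M\to M$ is additive with $F_M(rm)=d(r)m+rF_M(m)$ for all $r\in R,m\in M$ and $F_M(M_\tau)\subseteq M_\tau$ for all $\tau$. Addition is componentwise and pointwise; $(aF_M)(m)=aF_M(m)$, $(ad)(r)=a\,d(r)$. *)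

(* Defs.v *)
From HB Require Import structures.
From mathcomp Require Import all_boot all_order all_algebra.
From mathcomp Require Import boolp classical_sets.
Set Implicit Arguments.
Unset Strict Implicit.
Unset Printing Implicit Defensive.
Import GRing.Theory.
Local Open Scope ring_scope.
Local Open Scope classical_set_scope.

(* The abelian group indexing the gradings is a zmodType, hence written
   additively: its identity e is 0 and the product of s and t is s + t.
   Rings are associative with a unit (the zero ring is allowed), modules are
   unital left modules. *)

(* V is the internal direct sum of the additive subgroups g t, t : G. *)
Record direct_sum (G V : zmodType) (g : G -> set V) : Prop := DirectSum {
  direct_sum0 : forall t, g t 0;
  direct_sumB : forall t x y, g t x -> g t y -> g t (x - y);
  direct_sum_span : forall x : V, exists (s : seq G) (c : G -> V),
    [/\ uniq s, forall t, g t (c t) & x = \sum_(t <- s) c t];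
  direct_sum_indep : forall (s : seq G) (c : G -> V),
    uniq s -> (forall t, g t (c t)) -> \sum_(t <- s) c t = 0 ->
    forall t, t \in s -> c t = 0
}.

Record graded_ring (G : zmodType) (R : pzRingType) (gR : G -> set R) : Prop :=
  GradedRing {
    graded_ring_sum : direct_sum gR;
    graded_ringM : forall s t x y, gR s x -> gR t y -> gR (s + t) (x * y)
  }.

Record graded_module (G : zmodType) (R : pzRingType) (gR : G -> set R)
    (M : lmodType R) (gM : G -> set M) : Prop := GradedModule {
  graded_module_sum : direct_sum gM;
  graded_moduleZ : forall s t r m, gR s r -> gM t m -> gM (s + t) (r *: m)
}.

Definition ring_center (R : pzRingType) : set R :=
  [set a | forall x, GRing.comm a x].
Arguments ring_center : clear implicits.

Record gr_derivation (G : zmodType) (R : pzRingType) (gR : G -> set R)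
    (d : R -> R) : Prop := GrDerivation {
  gr_derD : forall x y, d (x + y) = d x + d y;
  gr_derM : forall x y, d (x * y) = d x * y + x * d y;
  gr_der_homog : forall t x, gR t x -> gR t (d x)
}.

Record gr_gen_derivation (G : zmodType) (R : pzRingType) (gR : G -> set R)
    (M : lmodType R) (gM : G -> set M) (F : M -> M) (d : R -> R) : Prop :=
  GrGenDerivation {
    gr_gen_der_der : gr_derivation gR d;
    gr_gen_derD : forall m n, F (m + n) = F m + F n;
    gr_gen_derZ : forall r m, F (r *: m) = d r *: m + r *: F m;
    gr_gen_der_homog : forall t m, gM t m -> gM t (F m)
  }.

Definition pDer (G : zmodType) (R : pzRingType) (gR : G -> set R)
    (M : lmodType R) (gM : G -> set M) : set ((M -> M) * (R -> R)) :=
  [set p | gr_gen_derivation gR gM p.1 p.2].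

(* Sets are coerced to the subtypes they define, with \val the inclusion.
   GRing.PzRing T and GRing.Lmodule S T are the types of ring structures and
   of left S-module structures on the type T. *)

(* The ring structure cS on the subset A is the one induced by R. *)
Definition induced_ring (R : pzRingType) (A : set R) (cS : GRing.PzRing A) :
    Prop :=
  let S : pzRingType := GRing.PzRing.Pack cS in
  [/\ forall a b : S, \val (a + b : A) = \val (a : A) + \val (b : A),
      forall a b : S, \val (a * b : A) = \val (a : A) * \val (b : A)
    & \val (1%R : S) = 1 :> R].

(* The module structure cV on D has pointwise addition and scalar
   multiplication; its zero and opposite are then determined. *)
Definition pointwise_module (R : pzRingType) (M : lmodType R) (A : set R)
    (cS : GRing.PzRing A) (D : set ((M -> M) * (R -> R)))
    (cV : GRing.Lmodule (GRing.PzRing.Pack cS) D) : Prop :=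
  let S : pzRingType := GRing.PzRing.Pack cS in
  let V : lmodType S := GRing.Lmodule.Pack cV in
  (forall u v : V, \val (u + v : D) =
     (fun m => (\val (u : D)).1 m + (\val (v : D)).1 m,
      fun r => (\val (u : D)).2 r + (\val (v : D)).2 r)) /\
  (forall (a : S) (u : V), \val (a *: u : D) =
     (fun m => \val (a : A) *: (\val (u : D)).1 m,
      fun r => \val (a : A) * (\val (u : D)).2 r)).

(* Main.v *)
Require Import Defs.
From HB Require Import structures.
From mathcomp Require Import all_boot all_order all_algebra.
From mathcomp Require Import boolp classical_sets.
From mathcomp Require Import functions.
Set Implicit Arguments.
Unset Strict Implicit.
Unset Printing Implicit Defensive.
Import GRing.Theory.
Local Open Scope ring_scope.
Local Open Scope classical_set_scope.

(** Endow [(M -> M) * (R -> R)] with its pointwise left [R]-module structure,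
    where [R] acts on the values [R] of the second factor by left
    multiplication.  The proposition then says that [Z(R) :&: R_0] is a subring
    of [R] and that the pairs [(F, d)] form an additive subgroup stable under
    the scalars of this subring; [subring_submodule] turns these closure
    properties into structures on the subtypes.

    Additive closure is formal ([pDerB]).  For a scalar [a], the pair
    [(a F, a d)] obeys the Leibniz rules because [a] is central, which allows
    [a (x d y) = x (a d y)], and it preserves degrees because [a] has degree
    [0] ([pDerZ]).

    That [Z(R) :&: R_0] is a subring is formal, except for [1 \in R_0]
    ([graded_ring1]): if [e] is the component of [1] of degree [0], then
    comparing components of degree [s] in [x = x * 1], for [x] of degree [s],
    gives [x = x * e].  Hence [e] is a right identity on all homogeneous
    elements, thus on all of [R], and [1 = 1 * e = e]. *)

Section DirectSum.
Variables (G V : zmodType) (g : G -> set V).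
Hypothesis hg : direct_sum g.

(** A decomposition may be padded with a null term, so that a prescribed
    degree [u] is always among those that are listed. *)
Lemma direct_sum_span_at (u : G) (x : V) : exists (s : seq G) (c : G -> V),
  [/\ uniq s, u \in s, forall t, g t (c t) & x = \sum_(t <- s) c t].
Proof.
have [s [c [us gc ->]]] := direct_sum_span hg x.
have [su|su] := boolP (u \in s); first by exists s, c.
exists (u :: s), (fun t => if t == u then 0 else c t).
split=> [||t|]; rewrite ?mem_head //= ?su //.
  by case: ifP => // _; apply: (direct_sum0 hg).
rewrite big_cons eqxx add0r big_seq [RHS]big_seq; apply: eq_bigr => t st.
by case: eqP => // tu; rewrite -tu st in su.
Qed.

End DirectSum.

(** By uniqueness of components, right multiplication by the component of [1] of
    degree [0] fixes every homogeneous element; so that component is [1]. *)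
Lemma graded_ring1 (G : zmodType) (R : pzRingType) (gR : G -> set R) :
  graded_ring gR -> gR 0 1.
Proof.
move=> [hg gM]; have [s [e [us s0 ge def1]]] := direct_sum_span_at hg 0 1.
have id_e t x : gR t x -> x * e 0 = x.
  move=> gx; pose c u := x * e (u - t) - (if u == t then x else 0).
  have gc u : gR u (c u).
    apply: (direct_sumB hg); first by rewrite -{1}[u](subrKC t); apply: gM.
    by case: eqP => [->//|_]; apply: (direct_sum0 hg).
  (* The terms [c u] are the components of [x * 1 - x], indexed by the degrees
     [t + v] of the products [x * e v]. *)
  have sum_c : \sum_(u <- [seq t + v | v <- s]) c u = 0.
    rewrite big_map sumrB; apply/eqP; rewrite subr_eq0; apply/eqP.
    have -> : \sum_(v <- s) (if t + v == t then x else 0) = x.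
      rewrite (bigD1_seq 0) //= addr0 eqxx big1 ?addr0 // => v v0.
      by rewrite -subr_eq0 addrC addKr (negPf v0).
    rewrite -[RHS]mulr1 def1 mulr_sumr; apply: eq_bigr => v _.
    by rewrite [t + v]addrC addrK.
  have tin : t \in [seq t + v | v <- s] by apply/mapP; exists 0; rewrite ?addr0.
  have ut : uniq [seq t + v | v <- s] by rewrite map_inj_uniq //; apply: addrI.
  have := direct_sum_indep hg ut gc sum_c tin.
  by rewrite /c eqxx subrr => /eqP; rewrite subr_eq0 => /eqP.
suff -> : 1 = e 0 by apply: ge.
rewrite -[RHS]mul1r {1 2}def1 mulr_suml.
by apply: eq_bigr => t _; rewrite (id_e t).
Qed.

Lemma subring_closed_center0 (G : zmodType) (R : pzRingType) (gR : G -> set R) :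
  graded_ring gR -> subring_closed (mem (ring_center R `&` gR 0)).
Proof.
move=> hR; have [hg gM] := hR; split=> [|x y|x y]; rewrite ?inE.
- by split; [move=> x; apply: commr_sym; apply: commr1 | apply: graded_ring1].
- move=> [cx gx] [cy gy]; split; last exact: (direct_sumB hg).
  by move=> z; apply/commr_sym/commrB; apply/commr_sym.
- move=> [cx gx] [cy gy]; split; last by rewrite -[0]addr0; apply: gM.
  by move=> z; apply/commr_sym/commrM; apply/commr_sym.
Qed.

Section PDer.
Variables (G : zmodType) (R : pzRingType) (gR : G -> set R).
Hypothesis hR : graded_ring gR.
Variables (M : lmodType R) (gM : G -> set M).
Hypothesis hM : graded_module gR gM.

Let hgR := graded_ring_sum hR.
Let hgM := graded_module_sum hM.

Lemma pDer0 : pDer gR gM (fun=> 0, fun=> 0).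
Proof.
split=> [||r m|t m _] /=; first split=> [x y|x y|t x _] /=.
- by rewrite addr0.
- by rewrite mul0r mulr0 addr0.
- exact: (direct_sum0 hgR).
- by move=> m n; rewrite addr0.
- by rewrite scale0r scaler0 addr0.
- exact: (direct_sum0 hgM).
Qed.

Lemma pDerB F F' d d' : pDer gR gM (F, d) -> pDer gR gM (F', d') ->
  pDer gR gM (fun m => F m - F' m, fun r => d r - d' r).
Proof.
case=> [[/= dD dM dg] FD FZ Fg] [[/= dD' dM' dg'] FD' FZ' Fg'].
split=> [|m n|r m|t m gm] /=; first split=> [x y|x y|t x gx] /=.
- by rewrite dD dD' opprD addrACA.
- by rewrite dM dM' opprD addrACA -mulrBl -mulrBr.
- by apply: (direct_sumB hgR); [apply: dg | apply: dg'].
- by rewrite FD FD' opprD addrACA.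
- by rewrite FZ FZ' opprD addrACA -scalerBl -scalerBr.
- by apply: (direct_sumB hgM); [apply: Fg | apply: Fg'].
Qed.

Lemma pDerZ a F d : (ring_center R `&` gR 0) a -> pDer gR gM (F, d) ->
  pDer gR gM (fun m => a *: F m, fun r => a * d r).
Proof.
move=> [ca ga] [[/= dD dM dg] FD FZ Fg].
split=> [|m n|r m|t m gm] /=; first split=> [x y|x y|t x gx] /=.
- by rewrite dD mulrDr.
- by rewrite dM mulrDr !mulrA [a * x]ca.
- by rewrite -[t]add0r; apply: (graded_ringM hR) => //; apply: dg.
- by rewrite FD scalerDr.
- by rewrite FZ scalerDr !scalerA [a * r]ca.
- by rewrite -[t]add0r; apply: (graded_moduleZ hM) => //; apply: Fg.
Qed.

End PDer.

(** The scalars form only the subring [A], and [D] need not be stable under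
    [R], so [D] is not a submodule over [R]: its addition is inherited as a
    subgroup, but the action of [A] is built by hand, and its axioms are pulled
    back along the injection of [D] into [V]. *)
Lemma subring_submodule (R : pzRingType) (V : lmodType R) (A : set R)
    (D : set V) :
    subring_closed (mem A) -> zmod_closed (mem D) ->
    (forall a v, A a -> D v -> D (a *: v)) ->
  exists cS : GRing.PzRing A, induced_ring cS /\
    exists cV : GRing.Lmodule (GRing.PzRing.Pack cS) D,
      let W := GRing.Lmodule.Pack cV in
      (forall u v : W, \val (u + v : D) = \val (u : D) + \val (v : D)) /\
      (forall (a : GRing.PzRing.Pack cS) (u : W),
         \val (a *: u : D) = \val (a : A) *: \val (u : D)).
Proof.
move=> subA subD stab.
pose S : subPzRingType (mem A) := HB.pack {x | x \in mem A}
  (GRing.SubChoice_isSubPzRing.Build R (mem A) {x | x \in mem A} subA).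
pose W : subZmodType (mem D) := HB.pack {x | x \in mem D}
  (GRing.SubChoice_isSubZmodule.Build V (mem D) {x | x \in mem D} subD).
have stabW (a : S) (u : W) : \val a *: \val u \in D.
  by rewrite inE; apply: stab; apply: set_mem; apply: valP.
pose sc (a : S) (u : W) : W := Sub (\val a *: \val u) (stabW a u).
have vsc a u : \val (sc a u) = \val a *: \val u by rewrite SubK.
have scA a b v : sc a (sc b v) = sc (a * b) v.
  by apply: val_inj; rewrite !vsc scalerA rmorphM.
have sc1 : left_id 1 sc.
  by move=> v; apply: val_inj; rewrite vsc rmorph1 scale1r.
have scDr : right_distributive sc +%R.
  by move=> a u v; apply: val_inj; rewrite [RHS]raddfD !vsc raddfD -scalerDr.
have scDl v : {morph sc^~ v : a b / a + b}.
  by move=> a b; apply: val_inj; rewrite [RHS]raddfD !vsc raddfD scalerDl.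
pose L : lmodType S :=
  HB.pack (W : Type) (GRing.Zmodule.class W)
    (GRing.Zmodule_isLmodule.Build S W scA sc1 scDr scDl).
exists (GRing.PzRing.class S); split.
  by split=> [a b|a b|]; [apply: (raddfD (val : S -> R))
    | apply: (rmorphM (val : S -> R)) | apply: (rmorph1 (val : S -> R))].
exists (GRing.Lmodule.class L); split=> [u v|a u].
  exact: (raddfD (val : W -> V)).
exact: vsc.
Qed.

Theorem proposition5p6 (G : zmodType) (R : pzRingType) (gR : G -> set R)
    (hR : graded_ring gR) (M : lmodType R) (gM : G -> set M)
    (hM : graded_module gR gM) :
  exists cS : GRing.PzRing (ring_center R `&` gR 0),
    induced_ring cS /\
    exists cV : GRing.Lmodule (GRing.PzRing.Pack cS) (pDer gR gM),
      pointwise_module cV.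
Proof.
(* With [R^o] as codomain, [R] acts on derivations by left multiplication. *)
pose maps : lmodType R := ((M -> M) * (R -> R^o))%type.
have subD : zmod_closed (mem (pDer gR gM : set maps)).
  split=> [|[F d] [F' d']]; rewrite !inE; first exact: (pDer0 hR hM).
  exact: (pDerB hR hM).
have stabD a (p : maps) :
    (ring_center R `&` gR 0) a -> pDer gR gM p -> pDer gR gM (a *: p).
  case: p => F d; exact: (pDerZ hR hM).
exact: (subring_submodule (subring_closed_center0 hR) subD stabD).
Qed.
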